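(* Let $\mathscr{F}\subseteq\mathscr{P}(\omega)$ be an $\omega$-closed family and let $(i_1,j_1,F_1)$ and $(i_2,j_2,F_2)$ be nonzero elements of $\boldsymbol{B}_{\mathbb{Z}}^{\mathscr{F}}$. Then, in $\boldsymbol{B}_{\mathbb{Z}}^{\mathscr{F}}$: (i) $(i_1,j_1,F_1)\mathscr{R}(i_2,j_2,F_2)$ if and only if $i_1=i_2$ and $F_1=F_2$; (ii) $(i_1,j_1,F_1)\mathscr{L}(i_2,j_2,F_2)$ if and only if $j_1=j_2$ and $F_1=F_2$; (iii) $(i_1,j_1,F_1)\mathscr{H}(i_2,j_2,F_2)$ if and only if $i_1=i_2$, $j_1=j_2$ and $F_1=F_2$; hence all $\mathscr{H}$-classes of $\boldsymbol{B}_{\mathbb{Z}}^{\mathscr{F}}$ are singletons; (iv) $(i_1,j_1,F_1)\mathscr{D}(i_2,j_2,F_2)$ if and only if $F_1=F_2$; (v) $(i_1,j_1,F_1)\mathscr{J}(i_2,j_2,F_2)$ if and only if there exist $k_1,k_2\in\omega$ such that $F_1\subseteq -k_1+F_2$ and $F_2\subseteq -k_2+F_1$.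
   Context: $\omega$ is the set of non-negative integers and $\mathscr{P}(\omega)$ is the family of all its subsets. For $n\in\mathbb{Z}$ and $A\subseteq\mathbb{Z}$ put $n+A=\{n+a: a\in A\}$ (so $n+\varnothing=\varnothing$). A family $\mathscr{F}\subseteq\mathscr{P}(\omega)$ is $\omega$-closed if $F_1\cap(-n+F_2)\in\mathscr{F}$ for all $n\in\omega$ and $F_1,F_2\in\mathscr{F}$. For an $\omega$-closed family $\mathscr{F}$, the set $\mathbb{Z}\times\mathbb{Z}\times\mathscr{F}$ carries the associative operation $$(i_1,j_1,F_1)\cdot(i_2,j_2,F_2)=\begin{cases}(i_1-j_1+i_2,\;j_2,\;(j_1-i_2+F_1)\cap F_2), & j_1<i_2;\\ (i_1,\;j_2,\;F_1\cap F_2), & j_1=i_2;\\ (i_1,\;j_1-i_2+j_2,\;F_1\cap(i_2-j_1+F_2)), & j_1>i_2.\end{cases}$$ If $\varnothing\in\mathscr{F}$, then $\boldsymbol{I}=\{(i,j,\varnothing): i,j\in\mathbb{Z}\}$ is an ideal and $\boldsymbol{B}_{\mathbb{Z}}^{\mathscr{F}}$ is defined as the Rees quotient $(\mathbb{Z}\times\mathbb{Z}\times\mathscr{F},\cdot)/\boldsymbol{I}$ ($\boldsymbol{I}$ is collapsed to one element, the zero); if $\varnothing\notin\mathscr{F}$, then $\boldsymbol{B}_{\mathbb{Z}}^{\mathscr{F}}=(\mathbb{Z}\times\mathbb{Z}\times\mathscr{F},\cdot)$. The nonzero elements of $\boldsymbol{B}_{\mathbb{Z}}^{\mathscr{F}}$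 are exactly the triples $(i,j,F)$ with $i,j\in\mathbb{Z}$, $F\in\mathscr{F}$, $F\neq\varnothing$. $\mathscr{R},\mathscr{L},\mathscr{H},\mathscr{D},\mathscr{J}$ denote the usual Green relations of a semigroup. *)

(* Defs.v *)
From HB Require Import structures.
From mathcomp Require Import all_boot all_order all_algebra zify.
From mathcomp Require Import boolp classical_sets.
Set Implicit Arguments.
Unset Strict Implicit.
Unset Printing Implicit Defensive.
Import Order.TTheory GRing.Theory Num.Theory.

Local Open Scope quotient_scope.
Local Open Scope classical_set_scope.

Section Green.
Local Open Scope group_scope.
Variable S : semigroupType.
Implicit Types a b : S.

(* The principal ideals a S^1, S^1 a and S^1 a S^1, where S^1 is S with an
   identity adjoined (if S already has one, adjoining another changes
   nothing here). *)
Definition right_ideal a : set S := a |` [set a * s | s in [set: S]].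

Definition left_ideal a : set S := a |` [set s * a | s in [set: S]].

Definition two_sided_ideal a : set S :=
  left_ideal a `|` right_ideal a
  `|` [set s * a * t | s in [set: S] & t in [set: S]].

Definition greenR a b : Prop := right_ideal a = right_ideal b.
Definition greenL a b : Prop := left_ideal a = left_ideal b.
Definition greenJ a b : Prop := two_sided_ideal a = two_sided_ideal b.
Definition greenH a b : Prop := greenL a b /\ greenR a b.
(* D = L o R, which equals R o L, the join of L and R. *)
Definition greenD a b : Prop := exists2 c, greenL a c & greenR c b.

Definition greenH_class a : set S := [set b | greenH a b].

End Green.

Section Rees.
Local Open Scope group_scope.
Variables (S : semigroupType) (I : set S).

Definition is_ideal := forall s x : S, I x -> I (s * x) /\ I (x * s).

Definition rees_rel (x y : S) : bool := `[< x = y \/ I x /\ I y >].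

Fact rees_rel_refl : reflexive rees_rel.
Proof. by move=> x; apply/asboolP; left. Qed.

Fact rees_rel_sym : symmetric rees_rel.
Proof.
by move=> x y; apply/asboolP/asboolP => -[->|[? ?]]; [left|right|left|right].
Qed.

Fact rees_rel_trans : transitive rees_rel.
Proof.
move=> y x z /asboolP[->//|[Ix Iy]] /asboolP[<-|[_ Iz]]; apply/asboolP; by right.
Qed.

Canonical rees_equiv := EquivRel rees_rel rees_rel_refl rees_rel_sym rees_rel_trans.

Definition rees_quotient (_ : is_ideal) : Type := {eq_quot rees_rel}.

Variable idI : is_ideal.
Local Notation Q := (rees_quotient idI).

HB.instance Definition _ := Choice.on Q.
HB.instance Definition _ := EqQuotient.on Q.

Definition rees_mul (x y : Q) : Q := \pi_Q (repr x * repr y).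

Lemma rees_piE (x y : S) : (\pi_Q x = \pi_Q y) <-> (x = y \/ I x /\ I y).
Proof.
split; first by move/eqmodP/asboolP.
by move=> h; apply/eqmodP/asboolP.
Qed.

Lemma rees_mul_pi (x y : S) : rees_mul (\pi_Q x) (\pi_Q y) = \pi_Q (x * y).
Proof.
apply/rees_piE.
have /rees_piE : \pi_Q (repr (\pi_Q x)) = \pi_Q x by rewrite reprK.
have /rees_piE : \pi_Q (repr (\pi_Q y)) = \pi_Q y by rewrite reprK.
move: (repr (\pi_Q x)) (repr (\pi_Q y)) => x' y' [->|[Iy' Iy]] [->|[Ix' Ix]]; first by left.
- by right; split; [case: (idI y Ix')|case: (idI y Ix)].
- by right; split; [case: (idI x Iy')|case: (idI x Iy)].
- by right; split; [case: (idI y' Ix')|case: (idI y Ix)].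
Qed.

Fact rees_mulA : associative rees_mul.
Proof.
elim/quotW=> x; elim/quotW=> y; elim/quotW=> z.
by rewrite (rees_mul_pi y z) (rees_mul_pi x) (rees_mul_pi x y) rees_mul_pi mulgA.
Qed.

HB.instance Definition _ := isSemigroup.Build Q rees_mulA.

End Rees.

Local Open Scope ring_scope.

Definition omega : set int := [set x | 0 <= x].

Definition shift (n : int) (A : set int) : set int := [set n + a | a in A].

Definition omega_closed (F : set (set int)) : Prop :=
  forall (n : nat) (A B : set int), F A -> F B -> F (A `&` shift (- n%:Z) B).

(* The product is defined on triples with arbitrary subsets of Z, where it is
   already associative, and then restricted to Z x Z x F. *)
Definition triple : Type := (int * int * set int)%type.

Definition triple_mul (x y : triple) : triple :=
  let: (i1, j1, A1) := x in
  let: (i2, j2, A2) := y in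
  if j1 < i2 then (i1 - j1 + i2, j2, shift (j1 - i2) A1 `&` A2)
  else if j1 == i2 then (i1, j2, A1 `&` A2)
  else (i1, j1 - i2 + j2, A1 `&` shift (i2 - j1) A2).

Lemma shiftE n A x : shift n A x = A (x - n).
Proof.
apply/propext; split; first by case=> a Aa <-; rewrite addrC addKr.
by move=> h; exists (x - n) => //; rewrite addrC subrK.
Qed.

Lemma shift0 A : shift 0 A = A.
Proof. by apply/funext => x; rewrite shiftE subr0. Qed.

Lemma triple_mulE i1 j1 A1 i2 j2 A2 :
  triple_mul (i1, j1, A1) (i2, j2, A2) =
  (i1 + Num.max 0 (i2 - j1), j2 + Num.max 0 (j1 - i2),
   shift (- Num.max 0 (i2 - j1)) A1 `&` shift (- Num.max 0 (j1 - i2)) A2).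
Proof.
rewrite /triple_mul; case: (ltgtP j1 i2) => h.
- have -> : Num.max 0 (i2 - j1) = i2 - j1 by lia.
  have -> : Num.max 0 (j1 - i2) = 0 by lia.
  by rewrite oppr0 shift0 addr0 opprB; congr (_, _, _); lia.
- have -> : Num.max 0 (i2 - j1) = 0 by lia.
  have -> : Num.max 0 (j1 - i2) = j1 - i2 by lia.
  by rewrite oppr0 shift0 addr0 opprB; congr (_, _, _); lia.
- by rewrite h subrr maxxx oppr0 !shift0 !addr0.
Qed.

Lemma triple_mulA : associative triple_mul.
Proof.
move=> [[i1 j1] A1] [[i2 j2] A2] [[i3 j3] A3].
rewrite !triple_mulE; congr (_, _, _); [lia|lia|].
have capE (A B : set int) x : (A `&` B) x = (A x /\ B x) by [].
apply/funext => x; rewrite !(capE, shiftE) andA.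
by congr ((A1 _ /\ A2 _) /\ A3 _); lia.
Qed.

Section BZF.
Variables (F : set (set int)) (Fcl : omega_closed F).

Lemma triple_mul_closed (x y : triple) :
  F x.2 -> F y.2 -> F (triple_mul x y).2.
Proof.
case: x y => [[i1 j1] A1] [[i2 j2] A2] /= FA FB.
case: (ltgtP j1 i2) => h /=.
- rewrite setIC; have -> : j1 - i2 = - (`|i2 - j1|%N)%:Z by lia.
  exact: Fcl.
- have -> : i2 - j1 = - (`|j1 - i2|%N)%:Z by lia.
  exact: Fcl.
- by rewrite -[A2]shift0 -oppr0; exact: (Fcl 0).
Qed.

(* Z x Z x F; the closure proof is an argument so that the semigroup structure
   below can be attached to the type. *)
Definition triples_in (_ : omega_closed F) : Type :=
  {x : triple | `[< F x.2 >]}.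

Local Notation T := (triples_in Fcl).
HB.instance Definition _ := Choice.on T.
HB.instance Definition _ := SubType.on T.

Definition mk_triple (i j : int) (A : set int) (FA : F A) : T :=
  exist _ (i, j, A) (asboolT FA).

Definition triples_mul (x y : T) : T :=
  exist _ (triple_mul (val x) (val y))
    (asboolT (triple_mul_closed (asboolW (valP x)) (asboolW (valP y)))).

Fact triples_mulA : associative triples_mul.
Proof. by move=> x y z; apply: val_inj; exact: triple_mulA. Qed.

HB.instance Definition _ := isSemigroup.Build T triples_mulA.

Definition empty_triples : set T := [set x | (val x).2 = set0].

Lemma empty_triples_ideal : is_ideal empty_triples.
Proof.
move=> s x; rewrite /empty_triples /mkset /=.
case: s x => [[[i1 j1] A1] /= ?] [[[i2 j2] A2] /= ?] /= ->.
have sh0 n : shift n set0 = set0 by rewrite /shift image_set0.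
by rewrite -!/(triple_mul (_, _, _) (_, _, _)) !triple_mulE /= !sh0 setI0 set0I.
Qed.

(* The Rees quotient by the empty triples if F contains the empty set, and the
   semigroup of triples itself otherwise. *)
Definition BZ_of (d : decidable (F set0)) : semigroupType :=
  if d then (rees_quotient empty_triples_ideal : semigroupType)
  else (T : semigroupType).

Definition BZ : semigroupType := BZ_of (pselect (F set0)).

Definition BZ_class_of (d : decidable (F set0)) : T -> BZ_of d :=
  if d is left _ as d return T -> BZ_of d
  then \pi_(rees_quotient empty_triples_ideal) else id.

Definition BZ_class : T -> BZ := BZ_class_of (pselect (F set0)).

Definition BZ_elt (i j : int) (A : set int) (FA : F A) : BZ :=
  BZ_class (mk_triple i j FA).

End BZF.

(* Main.v *)
Require Import Defs.
From HB Require Import structures.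
From mathcomp Require Import all_boot all_order all_algebra zify.
From mathcomp Require Import boolp classical_sets.
Set Implicit Arguments.
Unset Strict Implicit.
Unset Printing Implicit Defensive.
Import Order.TTheory GRing.Theory Num.Theory.
Local Open Scope classical_set_scope.
Local Open Scope ring_scope.

(** For nonzero elements, membership in a principal one-sided ideal can be read
off the coordinates: (i1, j1, A) lies in (i2, j2, B) S^1 iff i2 <= i1 and A is
contained in (i2 - i1) + B, and dually for left ideals with the second
coordinates.  Two-sided ideals are obtained by composing the two conditions,
the intermediate coordinates being free.  The shift in the first two criteria
vanishes as soon as the inequality holds both ways, whence A = B for R and L,
whereas for J the two shifts remain independent. *)

(** * Principal ideals and Green's relations in an arbitrary semigroup *)

Section GreenTheory.
Local Open Scope group_scope.
Variable S : semigroupType.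
Implicit Types a b c : S.

Lemma right_ideal_refl a : right_ideal a a.
Proof. by left. Qed.

Lemma left_ideal_refl a : left_ideal a a.
Proof. by left. Qed.

Lemma right_ideal_trans b a c :
  right_ideal a b -> right_ideal b c -> right_ideal a c.
Proof.
case=> [->//|[s _ <-]] [->|[t _ <-]]; first by right; exists s.
by right; exists (s * t); rewrite // mulgA.
Qed.

Lemma left_ideal_trans b a c :
  left_ideal a b -> left_ideal b c -> left_ideal a c.
Proof.
case=> [->//|[s _ <-]] [->|[t _ <-]]; first by right; exists s.
by right; exists (t * s); rewrite // mulgA.
Qed.

(** Left and right multiplications commute by associativity, so a right step followed by a left step
    can be reordered. This is what makes [two_sided_ideal] transitive once it is split into
    one-sided steps. *)
Lemma left_right_idealC a b c :
  left_ideal b c -> right_ideal a b ->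
  exists2 d, left_ideal a d & right_ideal d c.
Proof.
case=> [->|[s _ <-]] [->|[t _ <-]].
- by exists a; left.
- by exists a; [left|right; exists t].
- by exists (s * a); [right; exists s|left].
- exists (s * a); first by right; exists s.
  by right; exists t; rewrite // mulgA.
Qed.

Lemma two_sided_idealP a b :
  two_sided_ideal a b <-> exists2 c, left_ideal a c & right_ideal c b.
Proof.
split=> [[[lab|rab]|[s _ [t _ <-]]]|[c [->|[s _ <-]] [->|[t _ <-]]]].
- by exists b => //; exact: right_ideal_refl.
- by exists a => //; exact: left_ideal_refl.
- by exists (s * a); right; [exists s|exists t].
- by left; left; left.
- by left; right; right; exists t.
- by left; left; right; exists s.
- by right; exists s => //; exists t.
Qed.

Lemma two_sided_ideal_refl a : two_sided_ideal a a.
Proof. by left; left; left. Qed.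

Lemma two_sided_ideal_trans b a c :
  two_sided_ideal a b -> two_sided_ideal b c -> two_sided_ideal a c.
Proof.
move=> /two_sided_idealP[d ad db] /two_sided_idealP[e be ec].
have [f df fe] := left_right_idealC be db.
apply/two_sided_idealP; exists f; first exact: left_ideal_trans df.
exact: right_ideal_trans ec.
Qed.

Lemma greenRP a b : greenR a b <-> right_ideal b a /\ right_ideal a b.
Proof.
rewrite /greenR; split=> [eq_ab|[ba ab]].
  by split; [rewrite -eq_ab|rewrite eq_ab]; exact: right_ideal_refl.
by apply/seteqP; split=> c; exact: right_ideal_trans.
Qed.

Lemma greenLP a b : greenL a b <-> left_ideal b a /\ left_ideal a b.
Proof.
rewrite /greenL; split=> [eq_ab|[ba ab]].
  by split; [rewrite -eq_ab|rewrite eq_ab]; exact: left_ideal_refl.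
by apply/seteqP; split=> c; exact: left_ideal_trans.
Qed.

Lemma greenJP a b : greenJ a b <-> two_sided_ideal b a /\ two_sided_ideal a b.
Proof.
rewrite /greenJ; split=> [eq_ab|[ba ab]].
  by split; [rewrite -eq_ab|rewrite eq_ab]; exact: two_sided_ideal_refl.
by apply/seteqP; split=> c; exact: two_sided_ideal_trans.
Qed.

Lemma greenH_sym a b : greenH a b -> greenH b a.
Proof. by case. Qed.

End GreenTheory.

(** * Shifts of sets of integers *)

Lemma sub_shift_neq0 n (A B : set int) :
  A <> set0 -> A `<=` shift n B -> B <> set0.
Proof.
by move=> A0 AB B0; apply: A0; rewrite B0 /shift image_set0 subset0 in AB.
Qed.

Lemma shiftD m n A : shift (m + n) A = shift m (shift n A).
Proof. by apply/funext => x; rewrite !shiftE; congr (A _); lia. Qed.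

Lemma shiftS n (A B : set int) : A `<=` B -> shift n A `<=` shift n B.
Proof. exact: image_subset. Qed.

(** * Elements, equality and products in [BZ] *)

Section BZTheory.
Variables (F : set (set int)) (Fcl : omega_closed F).
Local Notation elt := (BZ_elt Fcl).

(** Together with the equality criterion and the surjectivity below, this absorbs the case
    distinction in the definition of [BZ]; later arguments treat the Rees quotient and the plain
    semigroup uniformly. *)
Lemma BZ_classM (x y : triples_in Fcl) :
  BZ_class (x * y)%g = (BZ_class x * BZ_class y)%g.
Proof.
rewrite /BZ_class /BZ; case: pselect => //= F0.
exact/esym/rees_mul_pi.
Qed.

(** Without the quotient the second disjunct cannot occur, since it would put the empty set in [F];
    hence one criterion serves both cases. *)
Lemma BZ_class_eq (x y : triples_in Fcl) :
  BZ_class x = BZ_class y <->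
  x = y \/ (val x).2 = set0 /\ (val y).2 = set0.
Proof.
rewrite /BZ_class /BZ; case: pselect => [F0|nF0] /=; first exact: rees_piE.
split=> [|[//|[x0 _]]]; first by left.
by case: nF0; rewrite -x0; exact: asboolW (valP x).
Qed.

Lemma BZ_class_surj (q : BZ Fcl) : exists x, q = BZ_class x.
Proof.
move: q; rewrite /BZ_class /BZ; case: pselect => [F0|nF0] /= q; last by exists q.
by exists (generic_quotient.repr q); rewrite generic_quotient.reprK.
Qed.

Lemma BZ_elt_surj (q : BZ Fcl) :
  exists i j A (FA : F A), q = elt i j FA.
Proof.
have [[[[i j] A] FA] ->] := BZ_class_surj q.
exists i, j, A, (asboolW FA); congr BZ_class; exact: val_inj.
Qed.

Lemma BZ_elt_eq i1 j1 A (FA : F A) i2 j2 B (FB : F B) :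
  elt i1 j1 FA = elt i2 j2 FB <->
  (i1, j1, A) = (i2, j2, B) \/ A = set0 /\ B = set0.
Proof.
split=> [/BZ_class_eq[/(congr1 val)|]|[eqAB|AB0]]; [by left|by right| |].
  by apply/BZ_class_eq; left; exact: val_inj.
by apply/BZ_class_eq; right.
Qed.

(** The truncated differences [k] and [l] merge the three cases of the product and leave only linear
    arithmetic; the last disjunct accounts for products that vanish in the quotient. *)
Lemma BZ_eltM_eq i1 j1 A (FA : F A) i2 j2 B (FB : F B) i j C (FC : F C) :
  (elt i1 j1 FA * elt i2 j2 FB)%g = elt i j FC <->
  let: k := Num.max 0 (i2 - j1) in
  let: l := Num.max 0 (j1 - i2) in
  [/\ i1 + k = i, j2 + l = j & shift (- k) A `&` shift (- l) B = C] \/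
  shift (- k) A `&` shift (- l) B = set0 /\ C = set0.
Proof.
rewrite /BZ_elt -BZ_classM BZ_class_eq.
have vE : val (mk_triple Fcl i1 j1 FA * mk_triple Fcl i2 j2 FB)%g =
  triple_mul (i1, j1, A) (i2, j2, B) by [].
rewrite vE triple_mulE /=; split=> [] [eq1|]; [|by right| |by right]; left.
  by have := congr1 val eq1; rewrite vE triple_mulE => -[].
by apply: val_inj; rewrite vE triple_mulE /=; case: eq1 => -> -> ->.
Qed.

(** * Principal ideals of [BZ] *)

Lemma right_ideal_BZ i1 j1 A (FA : F A) i2 j2 B (FB : F B) :
  A <> set0 ->
  right_ideal (elt i2 j2 FB) (elt i1 j1 FA) <->
  i2 <= i1 /\ A `<=` shift (i2 - i1) B.
Proof.
move=> A0; split=> [[/BZ_elt_eq[[-> _ ->]|[/A0//]]|[q _]]|[le_i sAB]].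
- by rewrite lexx subrr shift0; split.
- have [i [j [C [FC ->]]]] := BZ_elt_surj q.
  case/BZ_eltM_eq=> [[i1E _ <-]|[_ /A0//]].
  split; first by lia.
  have -> : i2 - i1 = - Num.max 0 (i - j2) by lia.
  exact: subIsetl.
(* The first coordinate of the factor exceeds [j2] by exactly [i1 - i2], which raises [i2] to [i1]
   and shifts [B] by [i2 - i1]; intersecting with [A] then gives [A]. *)
- right; exists (elt (j2 + (i1 - i2)) j1 FA) => //.
  apply/BZ_eltM_eq; left.
  have -> : Num.max 0 (j2 + (i1 - i2) - j2) = i1 - i2 by lia.
  have -> : Num.max 0 (j2 - (j2 + (i1 - i2))) = 0 by lia.
  by rewrite oppr0 shift0 opprB setIC; split; [lia|lia|exact/setIidPl].
Qed.

Lemma left_ideal_BZ i1 j1 A (FA : F A) i2 j2 B (FB : F B) :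
  A <> set0 ->
  left_ideal (elt i2 j2 FB) (elt i1 j1 FA) <->
  j2 <= j1 /\ A `<=` shift (j2 - j1) B.
Proof.
move=> A0; split=> [[/BZ_elt_eq[[_ -> ->]|[/A0//]]|[q _]]|[le_j sAB]].
- by rewrite lexx subrr shift0; split.
- have [i [j [C [FC ->]]]] := BZ_elt_surj q.
  case/BZ_eltM_eq=> [[_ j1E <-]|[_ /A0//]].
  split; first by lia.
  have -> : j2 - j1 = - Num.max 0 (j - i2) by lia.
  exact: subIsetr.
- right; exists (elt i1 (i2 + (j1 - j2)) FA) => //.
  apply/BZ_eltM_eq; left.
  have -> : Num.max 0 (i2 + (j1 - j2) - i2) = j1 - j2 by lia.
  have -> : Num.max 0 (i2 - (i2 + (j1 - j2))) = 0 by lia.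
  by rewrite oppr0 shift0 opprB; split; [lia|lia|exact/setIidPl].
Qed.

Lemma two_sided_ideal_BZ i1 j1 A (FA : F A) i2 j2 B (FB : F B) :
  A <> set0 ->
  two_sided_ideal (elt i2 j2 FB) (elt i1 j1 FA) <->
  exists k : nat, A `<=` shift (- k%:Z) B.
Proof.
move=> A0; split=> [/two_sided_idealP[c]|[k sAB]].
  have [i [j [C [FC ->]]]] := BZ_elt_surj c.
  move=> lc /(right_ideal_BZ _ _ _ _ _ _ A0)[le_i sAC].
  (* The intermediate element must be nonzero for the left criterion to apply to it. *)
  have C0 := sub_shift_neq0 A0 sAC.
  have [le_j sCB] := (left_ideal_BZ _ _ _ _ _ _ C0).1 lc.
  (* Both summands are nonnegative by [le_i] and [le_j], so the two shifts add up to one by a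
     nonpositive integer. *)
  exists (absz ((i1 - i) + (j - j2))).
  have -> : - (absz ((i1 - i) + (j - j2)))%:Z = (i - i1) + (j2 - j) by lia.
  by rewrite shiftD; apply: subset_trans sAC _; exact: shiftS.
(* The left step carries the whole shift by [- k]; the right step then keeps [i1] and [A] and only
   changes the second coordinate. *)
apply/two_sided_idealP; exists (elt i1 (j2 + k%:Z) FA).
  apply/left_ideal_BZ => //.
  have -> : j2 - (j2 + k%:Z) = - k%:Z by lia.
  by split=> //; lia.
by apply/right_ideal_BZ => //; rewrite lexx subrr shift0; split.
Qed.

(** * Green's relations of [BZ] *)

Lemma greenR_BZ i1 j1 A (FA : F A) i2 j2 B (FB : F B) :
  A <> set0 ->
  greenR (elt i1 j1 FA) (elt i2 j2 FB) <-> i1 = i2 /\ A = B.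
Proof.
move=> A0; split=> [/greenRP[]|[-> eqAB]].
  move=> /(right_ideal_BZ _ _ _ _ _ _ A0)[le1 sAB].
  move=> /(right_ideal_BZ _ _ _ _ _ _ (sub_shift_neq0 A0 sAB))[le2 sBA].
  have eq_i : i1 = i2 by lia.
  rewrite eq_i subrr !shift0 in sAB sBA.
  by split=> //; apply/seteqP.
have B0 : B <> set0 by rewrite -eqAB.
by apply/greenRP; split; apply/right_ideal_BZ; rewrite // lexx subrr shift0 eqAB; split.
Qed.

Lemma greenL_BZ i1 j1 A (FA : F A) i2 j2 B (FB : F B) :
  A <> set0 ->
  greenL (elt i1 j1 FA) (elt i2 j2 FB) <-> j1 = j2 /\ A = B.
Proof.
move=> A0; split=> [/greenLP[]|[-> eqAB]].
  move=> /(left_ideal_BZ _ _ _ _ _ _ A0)[le1 sAB].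
  move=> /(left_ideal_BZ _ _ _ _ _ _ (sub_shift_neq0 A0 sAB))[le2 sBA].
  have eq_j : j1 = j2 by lia.
  rewrite eq_j subrr !shift0 in sAB sBA.
  by split=> //; apply/seteqP.
have B0 : B <> set0 by rewrite -eqAB.
by apply/greenLP; split; apply/left_ideal_BZ; rewrite // lexx subrr shift0 eqAB; split.
Qed.

Lemma greenH_BZ i1 j1 A (FA : F A) i2 j2 B (FB : F B) :
  A <> set0 ->
  greenH (elt i1 j1 FA) (elt i2 j2 FB) <-> [/\ i1 = i2, j1 = j2 & A = B].
Proof.
move=> A0; rewrite /greenH greenL_BZ // greenR_BZ //.
by split=> [[[-> ->] [-> _]]|[-> -> ->]].
Qed.

Lemma greenD_BZ i1 j1 A (FA : F A) i2 j2 B (FB : F B) :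
  A <> set0 ->
  greenD (elt i1 j1 FA) (elt i2 j2 FB) <-> A = B.
Proof.
move=> A0; split=> [[c]|eqAB].
  have [i [j [C [FC ->]]]] := BZ_elt_surj c.
  move=> /(greenL_BZ _ _ _ _ _ _ A0)[_ eqAC].
  by rewrite eqAC in A0 * => /(greenR_BZ _ _ _ _ _ _ A0)[].
(* The intermediate element takes [j1] from the left end for L and [i2] from the right end for R. *)
by exists (elt i2 j1 FA); [apply/greenL_BZ|apply/greenR_BZ].
Qed.

Lemma greenJ_BZ i1 j1 A (FA : F A) i2 j2 B (FB : F B) :
  A <> set0 -> B <> set0 ->
  greenJ (elt i1 j1 FA) (elt i2 j2 FB) <->
  exists k1 k2 : nat, A `<=` shift (- k1%:Z) B /\ B `<=` shift (- k2%:Z) A.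
Proof.
move=> A0 B0; rewrite greenJP !two_sided_ideal_BZ //.
split=> [[[k1 sAB] [k2 sBA]]|[k1 [k2 [sAB sBA]]]]; first by exists k1, k2.
by split; [exists k1|exists k2].
Qed.

(** Extends the triviality of H from nonzero elements to all of [BZ], including the zero when there
    is one. *)
Lemma greenH_BZ_eq (x y : BZ Fcl) : greenH x y -> x = y.
Proof.
have [i1 [j1 [A [FA ->]]]] := BZ_elt_surj x.
have [i2 [j2 [B [FB ->]]]] := BZ_elt_surj y.
have [A0|/eqP A0] := eqVneq A set0; last first.
  by case/(greenH_BZ _ _ _ _ _ _ A0) => *; apply/BZ_elt_eq; left; congr (_, _, _).
have [B0|/eqP B0] := eqVneq B set0; first by move=> _; apply/BZ_elt_eq; right.
(* Here only [B] is nonempty, and [greenH_BZ] asks this of its first argument, so the relation is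
   reversed. *)
move=> /greenH_sym /(greenH_BZ _ _ _ _ _ _ B0)[*].
by apply/BZ_elt_eq; left; congr (_, _, _).
Qed.

End BZTheory.

Theorem mainTheorem3 (F : set (set int))
    (Fomega : F `<=` [set A | A `<=` omega]) (Fcl : omega_closed F) :
  (forall (i1 j1 i2 j2 : int) (F1 F2 : set int) (FF1 : F F1) (FF2 : F F2),
    F1 <> set0 -> F2 <> set0 ->
    let x1 := BZ_elt Fcl i1 j1 FF1 in
    let x2 := BZ_elt Fcl i2 j2 FF2 in
    [/\ greenR x1 x2 <-> i1 = i2 /\ F1 = F2,
        greenL x1 x2 <-> j1 = j2 /\ F1 = F2,
        greenH x1 x2 <-> [/\ i1 = i2, j1 = j2 & F1 = F2],
        greenD x1 x2 <-> F1 = F2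
      & greenJ x1 x2 <->
          exists k1 k2 : nat,
            F1 `<=` shift (- k1%:Z) F2 /\ F2 `<=` shift (- k2%:Z) F1]) /\
  (forall x : BZ Fcl, greenH_class x = [set x]).
Proof.
split=> [i1 j1 i2 j2 F1 F2 FF1 FF2 F10 F20 x1 x2|x].
  split; [exact: greenR_BZ|exact: greenL_BZ|exact: greenH_BZ|exact: greenD_BZ|].
  exact: greenJ_BZ.
apply/seteqP; split=> y /=; first by move/greenH_BZ_eq.
by move->; split.
Qed.
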